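(* Let $\mathbf{B}$ be a pointed category with binary products and coproducts, kernels of split epimorphisms and coequalizers of reflexive graphs. If the canonical functor $T:Act(\mathbf{B})\to Pt(\mathbf{B})$, $T(X,\xi,B)=(F(X,\xi,B),\overline{[0\ 1]},\sigma\iota_2,B)$, is an equivalence of categories, then there are equivalences of categories $$RG(\mathbf{B})\sim\text{Pre-X-Mod}(\mathbf{B}),\qquad PC(\mathbf{B})\sim 2\text{-ChainComp}(\mathbf{B}),$$ where: The objects of $\text{Pre-X-Mod}(\mathbf{B})$ are pairs $(h,\xi)$ with $h:X\to B$ a morphism in $\mathbf{B}$ and $\xi:B\flat X\to X$ an action $(X,\xi,B)$ in $Act(\mathbf{B})$ satisfying $[h\ 1]k=h\xi$, where $k:B\flat X\to X\sqcup B$ is the kernel of $[0\ 1]$. The objects of $2\text{-ChainComp}(\mathbf{B})$ are sequences $Z\xrightarrow{t}X\xrightarrow{h}B$ with $ht=0$, together with internal actions $$\xi_X:B\flat X\to X,\qquad \xi_Z:X\flat Z\to Z,\qquad \xi_{F(Z,X)}:F(X,B)\flat F(Z,X)\to F(Z,X)$$ (where $F(X,B)=F(X,\xi_X,B)$, $F(Z,X)=F(Z,\xi_Z,X)$) subject to $$[h\ 1]k_X=h\xi_X,\qquad [t\ 1]k_Z=t\xi_Z,$$ $$[\sigma\iota_1\overline{[t\ 1]}\ \ 1]\,k_{F(Z,X)}=\sigma\iota_1\overline{[t\ 1]}\,\xi_{F(Z,X)},$$ $$\overline{[0\ 1]}\,\xi_{F(Z,X)}=\xi_X\big(\overline{[h\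 1]}\flat\overline{[0\ 1]}\big),$$ $$\sigma\iota_2\,\xi_X=\xi_{F(Z,X)}\big(\sigma\iota_2\flat\sigma\iota_2\big),$$ where $k_X:B\flat X\to X\sqcup B$, $k_Z:X\flat Z\to Z\sqcup X$ and $k_{F(Z,X)}:F(X,B)\flat F(Z,X)\to F(Z,X)\sqcup F(X,B)$ are the kernels of the respective morphisms $[0\ 1]$.
   Context: A category is pointed if it is enriched in pointed sets: for every pair $X,Y$ of objects there is a specified morphism $0_{X,Y}:X\to Y$ with $0f=0$, $f0=0$ for all $f$ (no zero object assumed). A reflexive graph is a diagram $d,c:C_1\to C_0$, $e:C_0\to C_1$ with $de=1=ce$; $\mathbf{B}$ has coequalizers of reflexive graphs if the coequalizer of $d$ and $c$ exists for each of them. $\iota_1,\iota_2$ are coproduct injections and $[f\ g]$ is the morphism out of a coproduct with components $f,g$. $Pt(\mathbf{B})$: objects $(A,\alpha,\beta,B)$ with $\alpha:A\to B$, $\beta:B\to A$, $\alpha\beta=1_B$; morphisms are pairs $(f_1,f_0)$ with $\alpha'f_1=f_0\alpha$, $f_1\beta=\beta'f_0$. Internal actions. $k:B\flat X\to X\sqcup B$ denotes the chosen kernel of $[0\ 1]:X\sqcup B\to B$. $\eta_X:X\to B\flat X$ is determined by $k\eta_X=\iota_1$, and $\mu_X:B\flat(B\flat X)\to B\flat X$ by $k\mu_X=[k\ \iota_2]k'$, where $k':B\flat(B\flat X)\to(B\flat X)\sqcup B$ is the kernel of $[0\ 1]$. For $g:B\to B'$, $f:X\to X'$, $g\flat f:B\flat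 X\to B'\flat X'$ is the morphism induced by $f\sqcup g$ on kernels. $Act(\mathbf{B})$: objects are triples $(X,\xi,B)$ with $\xi:B\flat X\to X$, $\xi\eta_X=1$, $\xi\mu_X=\xi(1\flat\xi)$; a morphism $(X,\xi,B)\to(X',\xi',B')$ is a pair $(f:X\to X',g:B\to B')$ with $\xi'(g\flat f)=f\xi$. $F(X,\xi,B)$ (also written $F(X,B)$) is the coequalizer $\sigma:X\sqcup B\to F(X,\xi,B)$ of $[k\ \iota_2],\ \xi\sqcup 1:(B\flat X)\sqcup B\to X\sqcup B$. A morphism $[f\ g]:X\sqcup B\to D$ factors (uniquely) through $\sigma$ if and only if $[f\ g]k=f\xi$, and the factorization is denoted $\overline{[f\ g]}:F(X,\xi,B)\to D$. The symbol $\sigma$ is used for each such coequalizer, $\sigma\iota_1,\sigma\iota_2$ being the canonical morphisms into $F$. For a morphism $(f,g)$ in $Act(\mathbf{B})$, $F(f,g)$ is the induced morphism of coequalizers, and $T(f,g)=(F(f,g),g)$. $RG(\mathbf{B})$: category of reflexive graphs in $\mathbf{B}$, morphisms being pairs $(f_1,f_0)$ commuting with $d,c,e$. $PC(\mathbf{B})$ (internal precategories): objects consist of $\pi_1,\pi_2,m:C_2\to C_1$, $e_1,e_2:C_1\to C_2$, $d,c:C_1\to C_0$, $e:C_0\to C_1$ such that $\pi_2e_2=1$, $\pi_1e_1=1$, $de=1=ce$, $d\pi_1=c\pi_2$, $\pi_1e_2=ec$, $\pi_2e_1=ed$, $e_1e=e_2e$ (a split square), $dm=d\pi_2$, $cm=c\pi_1$,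 $me_1=1=me_2$; morphisms are triples commuting with all the structure. Morphisms in $\text{Pre-X-Mod}(\mathbf{B})$ from $(h,\xi)$ to $(h',\xi')$ are morphisms $(f,g):(X,\xi,B)\to(X',\xi',B')$ of $Act(\mathbf{B})$ with $h'f=gh$. Morphisms in $2\text{-ChainComp}(\mathbf{B})$ are triples $(f_Z,f_X,f_B)$ commuting with $t$ and $h$ such that $(f_X,f_B)$, $(f_Z,f_X)$ and $(F(f_Z,f_X),F(f_X,f_B))$ are morphisms of $Act(\mathbf{B})$ for the given actions. *)

(* Defs.v *)
(* Morphisms are compared with Leibniz equality; proof irrelevance is used only
   to compare morphisms that carry proofs. *)
From Stdlib Require Import ProofIrrelevance.

Set Implicit Arguments.
Unset Strict Implicit.
Unset Printing Implicit Defensive.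

Record Category := {
  obj :> Type;
  hom : obj -> obj -> Type;
  id : forall X, hom X X;
  comp : forall X Y Z, hom Y Z -> hom X Y -> hom X Z;
  comp_id_l : forall X Y (f : hom X Y), comp (id Y) f = f;
  comp_id_r : forall X Y (f : hom X Y), comp f (id X) = f;
  comp_assoc : forall W X Y Z (h : hom Y Z) (g : hom X Y) (f : hom W X),
    comp h (comp g f) = comp (comp h g) f
}.

Arguments hom {c} X Y.
Arguments id {c} X.
Arguments comp {c X Y Z} g f : rename.

Declare Scope cat_scope.
Delimit Scope cat_scope with cat.
Local Open Scope cat_scope.

Notation "g ∘ f" := (comp g f) (at level 40, left associativity) : cat_scope.

Record Functor (C D : Category) := {
  fobj :> C -> D;
  fmap : forall X Y : C, hom X Y -> hom (fobj X) (fobj Y);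
  fmap_id : forall X : C, fmap (id X) = id (fobj X);
  fmap_comp : forall (X Y Z : C) (g : hom Y Z) (f : hom X Y),
    fmap (g ∘ f) = fmap g ∘ fmap f
}.

Arguments fmap {C D} F {X Y} f : rename.

Definition id_functor (C : Category) : Functor C C :=
  {| fobj := fun X => X;
     fmap := fun X Y f => f;
     fmap_id := fun X => eq_refl;
     fmap_comp := fun X Y Z g f => eq_refl |}.

Definition comp_functor (C D E : Category) (G : Functor D E) (F : Functor C D)
  : Functor C E.
Proof.
refine {| fobj := fun X => G (F X);
          fmap := fun X Y f => fmap G (fmap F f) |}.
- intros X. now rewrite !fmap_id.
- intros X Y Z g f. now rewrite !fmap_comp.
Defined.

Definition is_iso (C : Category) (X Y : C) (f : hom X Y) : Prop :=
  exists g : hom Y X, g ∘ f = id X /\ f ∘ g = id Y.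

Definition naturally_isomorphic (C D : Category) (F G : Functor C D) : Prop :=
  exists eta : forall X : C, hom (F X) (G X),
    (forall (X Y : C) (f : hom X Y), fmap G f ∘ eta X = eta Y ∘ fmap F f) /\
    (forall X : C, is_iso (eta X)).

Definition is_equivalence (C D : Category) (F : Functor C D) : Prop :=
  exists G : Functor D C,
    naturally_isomorphic (comp_functor G F) (id_functor C) /\
    naturally_isomorphic (comp_functor F G) (id_functor D).

Definition equivalent_categories (C D : Category) : Prop :=
  exists F : Functor C D, is_equivalence F.

Record PointedCategory := {
  pcat :> Category;
  zero : forall X Y : pcat, hom X Y;
  zero_comp : forall (X Y Z : pcat) (f : hom X Y), zero Y Z ∘ f = zero X Z;
  comp_zero : forall (X Y Z : pcat) (f : hom Y Z), f ∘ zero X Y = zero X Z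
}.

Arguments zero {p} X Y.

Record Product (C : Category) (X Y : C) := {
  prod_obj : C;
  prod_fst : hom prod_obj X;
  prod_snd : hom prod_obj Y;
  pair : forall D : C, hom D X -> hom D Y -> hom D prod_obj;
  pair_fst : forall (D : C) (f : hom D X) (g : hom D Y),
    prod_fst ∘ pair f g = f;
  pair_snd : forall (D : C) (f : hom D X) (g : hom D Y),
    prod_snd ∘ pair f g = g;
  pair_unique : forall (D : C) (f : hom D X) (g : hom D Y) (u : hom D prod_obj),
    prod_fst ∘ u = f -> prod_snd ∘ u = g -> u = pair f g
}.

Record Coproduct (C : Category) (X Y : C) := {
  coprod_obj : C;
  inj1 : hom X coprod_obj;
  inj2 : hom Y coprod_obj;
  copair : forall D : C, hom X D -> hom Y D -> hom coprod_obj D;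
  copair_inj1 : forall (D : C) (f : hom X D) (g : hom Y D),
    copair f g ∘ inj1 = f;
  copair_inj2 : forall (D : C) (f : hom X D) (g : hom Y D),
    copair f g ∘ inj2 = g;
  copair_unique : forall (D : C) (f : hom X D) (g : hom Y D)
      (u : hom coprod_obj D),
    u ∘ inj1 = f -> u ∘ inj2 = g -> u = copair f g
}.

Record Kernel (C : PointedCategory) (A B : C) (a : hom A B) := {
  ker_obj : C;
  ker_map : hom ker_obj A;
  ker_zero : a ∘ ker_map = zero ker_obj B;
  ker_lift : forall (D : C) (f : hom D A), a ∘ f = zero D B -> hom D ker_obj;
  ker_lift_map : forall (D : C) (f : hom D A) (H : a ∘ f = zero D B),
    ker_map ∘ ker_lift H = f;
  ker_lift_unique : forall (D : C) (f : hom D A) (H : a ∘ f = zero D B)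
      (u : hom D ker_obj),
    ker_map ∘ u = f -> u = ker_lift H
}.

Record Coequalizer (C : Category) (A B : C) (u v : hom A B) := {
  coeq_obj : C;
  coeq_map : hom B coeq_obj;
  coeq_eq : coeq_map ∘ u = coeq_map ∘ v;
  coeq_desc : forall (D : C) (f : hom B D), f ∘ u = f ∘ v -> hom coeq_obj D;
  coeq_desc_map : forall (D : C) (f : hom B D) (H : f ∘ u = f ∘ v),
    coeq_desc H ∘ coeq_map = f;
  coeq_desc_unique : forall (D : C) (f : hom B D) (H : f ∘ u = f ∘ v)
      (w : hom coeq_obj D),
    w ∘ coeq_map = f -> w = coeq_desc H
}.

Record Point (C : Category) := {
  pt_A : C;
  pt_B : C;
  pt_alpha : hom pt_A pt_B;
  pt_beta : hom pt_B pt_A;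
  pt_split : pt_alpha ∘ pt_beta = id pt_B
}.

Record PointHom (C : Category) (P Q : Point C) := {
  pth_1 : hom (pt_A P) (pt_A Q);
  pth_0 : hom (pt_B P) (pt_B Q);
  pth_alpha : pt_alpha Q ∘ pth_1 = pth_0 ∘ pt_alpha P;
  pth_beta : pth_1 ∘ pt_beta P = pt_beta Q ∘ pth_0
}.

Lemma PointHom_eq (C : Category) (P Q : Point C) (f g : PointHom P Q) :
  pth_1 f = pth_1 g -> pth_0 f = pth_0 g -> f = g.
Proof.
destruct f, g; simpl; intros; subst; f_equal; apply proof_irrelevance.
Qed.

(* Squares [b' ∘ p = q ∘ b] compose and contain identities. *)
Lemma square_id (C : Category) (X Y : C) (b : hom X Y) : b ∘ id X = id Y ∘ b.
Proof. now rewrite comp_id_l, comp_id_r. Qed.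

Lemma square_comp (C : Category) (X Y X' Y' X'' Y'' : C)
    (b : hom X Y) (b' : hom X' Y') (b'' : hom X'' Y'')
    (p : hom X X') (q : hom Y Y') (p' : hom X' X'') (q' : hom Y' Y'') :
  b' ∘ p = q ∘ b -> b'' ∘ p' = q' ∘ b' -> b'' ∘ (p' ∘ p) = (q' ∘ q) ∘ b.
Proof.
intros H H'. now rewrite comp_assoc, H', <- comp_assoc, H, comp_assoc.
Qed.

Definition Pt (C : Category) : Category.
Proof.
refine {| obj := Point C;
  hom := @PointHom C;
  id := fun P => {| pth_1 := id (pt_A P); pth_0 := id (pt_B P);
                    pth_alpha := square_id (pt_alpha P);
                    pth_beta := eq_sym (square_id (pt_beta P)) |};
  comp := fun P Q R g f =>
    {| pth_1 := pth_1 g ∘ pth_1 f; pth_0 := pth_0 g ∘ pth_0 f;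
       pth_alpha := square_comp (pth_alpha f) (pth_alpha g);
       pth_beta := eq_sym (square_comp (eq_sym (pth_beta f))
                                       (eq_sym (pth_beta g))) |} |};
  intros; apply PointHom_eq; simpl;
  auto using comp_id_l, comp_id_r, comp_assoc.
Defined.

Record ReflexiveGraph (C : Category) := {
  rg_1 : C;
  rg_0 : C;
  rg_d : hom rg_1 rg_0;
  rg_c : hom rg_1 rg_0;
  rg_e : hom rg_0 rg_1;
  rg_de : rg_d ∘ rg_e = id rg_0;
  rg_ce : rg_c ∘ rg_e = id rg_0
}.

Record ReflexiveGraphHom (C : Category) (G H : ReflexiveGraph C) := {
  rgh_1 : hom (rg_1 G) (rg_1 H);
  rgh_0 : hom (rg_0 G) (rg_0 H);
  rgh_d : rg_d H ∘ rgh_1 = rgh_0 ∘ rg_d G;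
  rgh_c : rg_c H ∘ rgh_1 = rgh_0 ∘ rg_c G;
  rgh_e : rg_e H ∘ rgh_0 = rgh_1 ∘ rg_e G
}.

Lemma ReflexiveGraphHom_eq (C : Category) (G H : ReflexiveGraph C)
    (f g : ReflexiveGraphHom G H) :
  rgh_1 f = rgh_1 g -> rgh_0 f = rgh_0 g -> f = g.
Proof.
destruct f, g; simpl; intros; subst; f_equal; apply proof_irrelevance.
Qed.

Definition RG (C : Category) : Category.
Proof.
refine {| obj := ReflexiveGraph C;
  hom := @ReflexiveGraphHom C;
  id := fun G => {| rgh_1 := id (rg_1 G); rgh_0 := id (rg_0 G);
                    rgh_d := square_id (rg_d G);
                    rgh_c := square_id (rg_c G);
                    rgh_e := square_id (rg_e G) |};
  comp := fun G H K g f =>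
    {| rgh_1 := rgh_1 g ∘ rgh_1 f; rgh_0 := rgh_0 g ∘ rgh_0 f;
       rgh_d := square_comp (rgh_d f) (rgh_d g);
       rgh_c := square_comp (rgh_c f) (rgh_c g);
       rgh_e := square_comp (rgh_e f) (rgh_e g) |} |};
  intros; apply ReflexiveGraphHom_eq; simpl;
  auto using comp_id_l, comp_id_r, comp_assoc.
Defined.

Record Precategory (C : Category) := {
  pc_2 : C;
  pc_1 : C;
  pc_0 : C;
  pc_pi1 : hom pc_2 pc_1;
  pc_pi2 : hom pc_2 pc_1;
  pc_m : hom pc_2 pc_1;
  pc_e1 : hom pc_1 pc_2;
  pc_e2 : hom pc_1 pc_2;
  pc_d : hom pc_1 pc_0;
  pc_c : hom pc_1 pc_0;
  pc_e : hom pc_0 pc_1;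
  pc_pi2_e2 : pc_pi2 ∘ pc_e2 = id pc_1;
  pc_pi1_e1 : pc_pi1 ∘ pc_e1 = id pc_1;
  pc_d_e : pc_d ∘ pc_e = id pc_0;
  pc_c_e : pc_c ∘ pc_e = id pc_0;
  pc_d_pi1 : pc_d ∘ pc_pi1 = pc_c ∘ pc_pi2;
  pc_pi1_e2 : pc_pi1 ∘ pc_e2 = pc_e ∘ pc_c;
  pc_pi2_e1 : pc_pi2 ∘ pc_e1 = pc_e ∘ pc_d;
  pc_e1_e : pc_e1 ∘ pc_e = pc_e2 ∘ pc_e;
  pc_d_m : pc_d ∘ pc_m = pc_d ∘ pc_pi2;
  pc_c_m : pc_c ∘ pc_m = pc_c ∘ pc_pi1;
  pc_m_e1 : pc_m ∘ pc_e1 = id pc_1;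
  pc_m_e2 : pc_m ∘ pc_e2 = id pc_1
}.

Record PrecategoryHom (C : Category) (P Q : Precategory C) := {
  pch_2 : hom (pc_2 P) (pc_2 Q);
  pch_1 : hom (pc_1 P) (pc_1 Q);
  pch_0 : hom (pc_0 P) (pc_0 Q);
  pch_pi1 : pc_pi1 Q ∘ pch_2 = pch_1 ∘ pc_pi1 P;
  pch_pi2 : pc_pi2 Q ∘ pch_2 = pch_1 ∘ pc_pi2 P;
  pch_m : pc_m Q ∘ pch_2 = pch_1 ∘ pc_m P;
  pch_e1 : pc_e1 Q ∘ pch_1 = pch_2 ∘ pc_e1 P;
  pch_e2 : pc_e2 Q ∘ pch_1 = pch_2 ∘ pc_e2 P;
  pch_d : pc_d Q ∘ pch_1 = pch_0 ∘ pc_d P;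
  pch_c : pc_c Q ∘ pch_1 = pch_0 ∘ pc_c P;
  pch_e : pc_e Q ∘ pch_0 = pch_1 ∘ pc_e P
}.

Lemma PrecategoryHom_eq (C : Category) (P Q : Precategory C)
    (f g : PrecategoryHom P Q) :
  pch_2 f = pch_2 g -> pch_1 f = pch_1 g -> pch_0 f = pch_0 g -> f = g.
Proof.
destruct f, g; simpl; intros; subst; f_equal; apply proof_irrelevance.
Qed.

Definition PC (C : Category) : Category.
Proof.
refine {| obj := Precategory C;
  hom := @PrecategoryHom C;
  id := fun P =>
    {| pch_2 := id (pc_2 P); pch_1 := id (pc_1 P); pch_0 := id (pc_0 P);
       pch_pi1 := square_id (pc_pi1 P);
       pch_pi2 := square_id (pc_pi2 P);
       pch_m := square_id (pc_m P);
       pch_e1 := square_id (pc_e1 P);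
       pch_e2 := square_id (pc_e2 P);
       pch_d := square_id (pc_d P);
       pch_c := square_id (pc_c P);
       pch_e := square_id (pc_e P) |};
  comp := fun P Q R g f =>
    {| pch_2 := pch_2 g ∘ pch_2 f; pch_1 := pch_1 g ∘ pch_1 f;
       pch_0 := pch_0 g ∘ pch_0 f;
       pch_pi1 := square_comp (pch_pi1 f) (pch_pi1 g);
       pch_pi2 := square_comp (pch_pi2 f) (pch_pi2 g);
       pch_m := square_comp (pch_m f) (pch_m g);
       pch_e1 := square_comp (pch_e1 f) (pch_e1 g);
       pch_e2 := square_comp (pch_e2 f) (pch_e2 g);
       pch_d := square_comp (pch_d f) (pch_d g);
       pch_c := square_comp (pch_c f) (pch_c g);
       pch_e := square_comp (pch_e f) (pch_e g) |} |};
  intros; apply PrecategoryHom_eq; simpl;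
  auto using comp_id_l, comp_id_r, comp_assoc.
Defined.

(* Limits and colimits are given as choices, so that the kernel [B ♭ X] and the
   coequalizer [F] below are functions of their data. *)
Definition BinaryProducts (C : Category) : Type :=
  forall X Y : C, Product X Y.

Definition BinaryCoproducts (C : Category) : Type :=
  forall X Y : C, Coproduct X Y.

Definition SplitEpiKernels (C : PointedCategory) : Type :=
  forall P : Point C, Kernel (pt_alpha P).

Definition ReflexiveCoequalizers (C : Category) : Type :=
  forall G : ReflexiveGraph C, Coequalizer (rg_d G) (rg_c G).

Section InternalActions.

Context (C : PointedCategory).
Context (coprods : BinaryCoproducts C).
Context (kers : SplitEpiKernels C).
Context (coeqs : ReflexiveCoequalizers C).

Local Notation "X ⊔ Y" := (coprod_obj (coprods X Y))
  (at level 50, left associativity).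
Local Notation "[ f , g ]" := (copair (coprods _ _) f g) (at level 0).

Definition iota1 (X Y : C) : hom X (X ⊔ Y) := inj1 (coprods X Y).
Definition iota2 (X Y : C) : hom Y (X ⊔ Y) := inj2 (coprods X Y).
Arguments iota1 {X Y}.
Arguments iota2 {X Y}.

Lemma copair_iota1 (X Y D : C) (f : hom X D) (g : hom Y D) :
  [f, g] ∘ iota1 = f.
Proof. apply copair_inj1. Qed.

Lemma copair_iota2 (X Y D : C) (f : hom X D) (g : hom Y D) :
  [f, g] ∘ iota2 = g.
Proof. apply copair_inj2. Qed.

Lemma coprod_ext (X Y D : C) (u v : hom (X ⊔ Y) D) :
  u ∘ iota1 = v ∘ iota1 -> u ∘ iota2 = v ∘ iota2 -> u = v.
Proof.
intros H1 H2. transitivity [v ∘ iota1, v ∘ iota2].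
- now apply copair_unique.
- symmetry. now apply copair_unique.
Qed.

Lemma comp_copair (X Y D E : C) (f : hom X D) (g : hom Y D) (h : hom D E) :
  h ∘ [f, g] = [h ∘ f, h ∘ g].
Proof.
apply copair_unique; rewrite <- comp_assoc.
- now rewrite copair_inj1.
- now rewrite copair_inj2.
Qed.

Definition coprod_map (X X' Y Y' : C) (f : hom X X') (g : hom Y Y')
  : hom (X ⊔ Y) (X' ⊔ Y') := [iota1 ∘ f, iota2 ∘ g].

Local Notation "f ⊔m g" := (coprod_map f g) (at level 50, left associativity).

Lemma copair_map (X X' Y Y' D : C) (f : hom X' D) (g : hom Y' D)
    (u : hom X X') (v : hom Y Y') :
  [f, g] ∘ (u ⊔m v) = [f ∘ u, g ∘ v].
Proof.
unfold coprod_map.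
now rewrite comp_copair, !comp_assoc, copair_iota1, copair_iota2.
Qed.

Lemma coprod_map_id (X Y : C) : id X ⊔m id Y = id (X ⊔ Y).
Proof.
unfold coprod_map. symmetry.
apply copair_unique; now rewrite comp_id_l, comp_id_r.
Qed.

Lemma coprod_map_comp (X X' X'' Y Y' Y'' : C) (f' : hom X' X'') (f : hom X X')
    (g' : hom Y' Y'') (g : hom Y Y') :
  (f' ∘ f) ⊔m (g' ∘ g) = (f' ⊔m g') ∘ (f ⊔m g).
Proof.
unfold coprod_map at 2. rewrite copair_map.
unfold coprod_map. now rewrite !comp_assoc.
Qed.

(* The split epimorphism [0 1] : X ⊔ B -> B, with section [iota2]. *)
Definition proj_point (B X : C) : Point C :=
  {| pt_A := X ⊔ B; pt_B := B;
     pt_alpha := [zero X B, id B]; pt_beta := iota2;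
     pt_split := copair_iota2 (zero X B) (id B) |}.

(* The acting object comes first, here and in [flat_map] and [Action]; in
   [is_act_hom] the component [f] on the object acted upon comes first. *)
Definition flat (B X : C) : C := ker_obj (kers (proj_point B X)).

Local Notation "B ♭ X" := (flat B X) (at level 45, right associativity).

Definition flat_k (B X : C) : hom (B ♭ X) (X ⊔ B) :=
  ker_map (kers (proj_point B X)).
Arguments flat_k {B X}.

Lemma flat_k_zero (B X : C) : [zero X B, id B] ∘ flat_k = zero (B ♭ X) B.
Proof. exact (ker_zero (kers (proj_point B X))). Qed.

Definition flat_lift (B X D : C) (f : hom D (X ⊔ B))
    (H : [zero X B, id B] ∘ f = zero D B) : hom D (B ♭ X) :=
  @ker_lift _ _ _ _ (kers (proj_point B X)) D f H.

Lemma flat_k_lift (B X D : C) (f : hom D (X ⊔ B))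
    (H : [zero X B, id B] ∘ f = zero D B) : flat_k ∘ flat_lift H = f.
Proof. exact (ker_lift_map (kers (proj_point B X)) H). Qed.

Lemma flat_ext (B X D : C) (u v : hom D (B ♭ X)) :
  flat_k ∘ u = flat_k ∘ v -> u = v.
Proof.
intros H.
assert (Hv : [zero X B, id B] ∘ (flat_k ∘ v) = zero D B).
{ now rewrite comp_assoc, flat_k_zero, zero_comp. }
transitivity (flat_lift Hv).
- now apply (@ker_lift_unique _ _ _ _ (kers (proj_point B X))).
- symmetry. now apply (@ker_lift_unique _ _ _ _ (kers (proj_point B X))).
Qed.

Lemma flat_eta_zero (B X : C) :
  [zero X B, id B] ∘ iota1 = zero X B.
Proof. apply copair_iota1. Qed.

Definition flat_eta (B X : C) : hom X (B ♭ X) :=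
  flat_lift (flat_eta_zero B X).

Lemma flat_k_eta (B X : C) : flat_k ∘ flat_eta B X = iota1.
Proof. apply flat_k_lift. Qed.

Lemma flat_mu_zero (B X : C) :
  [zero X B, id B] ∘ ([flat_k, iota2] ∘ flat_k) = zero (B ♭ (B ♭ X)) B.
Proof.
rewrite comp_assoc, comp_copair, flat_k_zero, copair_iota2.
apply flat_k_zero.
Qed.

Definition flat_mu (B X : C) : hom (B ♭ (B ♭ X)) (B ♭ X) :=
  flat_lift (flat_mu_zero B X).

Lemma flat_map_zero (B B' X X' : C) (g : hom B B') (f : hom X X') :
  [zero X' B', id B'] ∘ ((f ⊔m g) ∘ flat_k) = zero (B ♭ X) B'.
Proof.
rewrite comp_assoc, copair_map, zero_comp, comp_id_l.
assert (E : [zero X B', g] = g ∘ [zero X B, id B])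
  by now rewrite comp_copair, comp_zero, comp_id_r.
rewrite E, <- comp_assoc, flat_k_zero.
apply comp_zero.
Qed.

Definition flat_map (B B' X X' : C) (g : hom B B') (f : hom X X')
  : hom (B ♭ X) (B' ♭ X') := flat_lift (flat_map_zero g f).

Local Notation "g ♭m f" := (flat_map g f) (at level 45, right associativity).

Lemma flat_k_map (B B' X X' : C) (g : hom B B') (f : hom X X') :
  flat_k ∘ (g ♭m f) = (f ⊔m g) ∘ flat_k.
Proof. apply flat_k_lift. Qed.

Lemma flat_map_id (B X : C) : id B ♭m id X = id (B ♭ X).
Proof.
apply flat_ext. now rewrite flat_k_map, coprod_map_id, comp_id_l, comp_id_r.
Qed.

Lemma flat_map_comp (B B' B'' X X' X'' : C) (g' : hom B' B'') (g : hom B B')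
    (f' : hom X' X'') (f : hom X X') :
  (g' ∘ g) ♭m (f' ∘ f) = (g' ♭m f') ∘ (g ♭m f).
Proof.
apply flat_ext.
rewrite flat_k_map, comp_assoc, flat_k_map, <- comp_assoc, flat_k_map.
now rewrite coprod_map_comp, comp_assoc.
Qed.

Record Action (B X : C) := {
  act_map :> hom (B ♭ X) X;
  act_eta : act_map ∘ flat_eta B X = id X;
  act_mu : act_map ∘ flat_mu B X = act_map ∘ (id B ♭m act_map)
}.

Definition is_act_hom (B X B' X' : C) (xi : Action B X) (xi' : Action B' X')
    (f : hom X X') (g : hom B B') : Prop :=
  xi' ∘ (g ♭m f) = f ∘ xi.

Lemma is_act_hom_id (B X : C) (xi : Action B X) :
  is_act_hom xi xi (id X) (id B).
Proof.
unfold is_act_hom. now rewrite flat_map_id, comp_id_l, comp_id_r.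
Qed.

Lemma is_act_hom_comp (B X B' X' B'' X'' : C) (xi : Action B X)
    (xi' : Action B' X') (xi'' : Action B'' X'')
    (f : hom X X') (g : hom B B') (f' : hom X' X'') (g' : hom B' B'') :
  is_act_hom xi xi' f g -> is_act_hom xi' xi'' f' g' ->
  is_act_hom xi xi'' (f' ∘ f) (g' ∘ g).
Proof.
unfold is_act_hom. intros H H'. rewrite flat_map_comp.
now apply square_comp with (b' := act_map xi').
Qed.

Record ActionObj := {
  ao_X : C;
  ao_B : C;
  ao_xi : Action ao_B ao_X
}.

Record ActionHom (A A' : ActionObj) := {
  ah_X : hom (ao_X A) (ao_X A');
  ah_B : hom (ao_B A) (ao_B A');
  ah_xi : is_act_hom (ao_xi A) (ao_xi A') ah_X ah_B
}.

Lemma ActionHom_eq (A A' : ActionObj) (f g : ActionHom A A') :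
  ah_X f = ah_X g -> ah_B f = ah_B g -> f = g.
Proof.
destruct f, g; simpl; intros; subst; f_equal; apply proof_irrelevance.
Qed.

Definition Act : Category.
Proof.
refine {| obj := ActionObj;
  hom := ActionHom;
  id := fun A => {| ah_X := id (ao_X A); ah_B := id (ao_B A);
                    ah_xi := is_act_hom_id (ao_xi A) |};
  comp := fun A A' A'' g f =>
    {| ah_X := ah_X g ∘ ah_X f; ah_B := ah_B g ∘ ah_B f;
       ah_xi := is_act_hom_comp (ah_xi f) (ah_xi g) |} |};
  intros; apply ActionHom_eq; simpl;
  auto using comp_id_l, comp_id_r, comp_assoc.
Defined.

Lemma F_graph_d (B X : C) :
  [flat_k, iota2] ∘ (flat_eta B X ⊔m id B) = id (X ⊔ B).
Proof.
rewrite copair_map, flat_k_eta, comp_id_r.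
apply coprod_ext.
- now rewrite copair_iota1, comp_id_l.
- now rewrite copair_iota2, comp_id_l.
Qed.

Lemma F_graph_c (B X : C) (xi : Action B X) :
  (xi ⊔m id B) ∘ (flat_eta B X ⊔m id B) = id (X ⊔ B).
Proof.
now rewrite <- coprod_map_comp, act_eta, comp_id_l, coprod_map_id.
Qed.

(* The pair defining [F] is reflexive, with common section [eta ⊔ 1]. *)
Definition F_graph (B X : C) (xi : Action B X) : ReflexiveGraph C :=
  {| rg_1 := (B ♭ X) ⊔ B; rg_0 := X ⊔ B;
     rg_d := [flat_k, iota2];
     rg_c := xi ⊔m id B;
     rg_e := flat_eta B X ⊔m id B;
     rg_de := F_graph_d B X;
     rg_ce := F_graph_c xi |}.

Definition F (B X : C) (xi : Action B X) : C := coeq_obj (coeqs (F_graph xi)).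

Definition sigma (B X : C) (xi : Action B X) : hom (X ⊔ B) (F xi) :=
  coeq_map (coeqs (F_graph xi)).

Lemma sigma_eq (B X : C) (xi : Action B X) :
  sigma xi ∘ [flat_k, iota2] = sigma xi ∘ (xi ⊔m id B).
Proof. exact (coeq_eq (coeqs (F_graph xi))). Qed.

Definition F_desc (B X : C) (xi : Action B X) (D : C) (u : hom (X ⊔ B) D)
    (H : u ∘ [flat_k, iota2] = u ∘ (xi ⊔m id B)) : hom (F xi) D :=
  @coeq_desc _ _ _ _ _ (coeqs (F_graph xi)) D u H.

Lemma F_desc_sigma (B X : C) (xi : Action B X) (D : C) (u : hom (X ⊔ B) D)
    (H : u ∘ [flat_k, iota2] = u ∘ (xi ⊔m id B)) :
  F_desc H ∘ sigma xi = u.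
Proof. exact (coeq_desc_map (coeqs (F_graph xi)) H). Qed.

Lemma F_ext (B X : C) (xi : Action B X) (D : C) (u v : hom (F xi) D) :
  u ∘ sigma xi = v ∘ sigma xi -> u = v.
Proof.
intros H.
assert (Hv : (v ∘ sigma xi) ∘ [flat_k, iota2]
             = (v ∘ sigma xi) ∘ (xi ⊔m id B)).
{ now rewrite <- !comp_assoc, sigma_eq. }
transitivity (F_desc Hv).
- now apply (@coeq_desc_unique _ _ _ _ _ (coeqs (F_graph xi))).
- symmetry. now apply (@coeq_desc_unique _ _ _ _ _ (coeqs (F_graph xi))).
Qed.

Definition sigma_iota1 (B X : C) (xi : Action B X) : hom X (F xi) :=
  sigma xi ∘ iota1.

Definition sigma_iota2 (B X : C) (xi : Action B X) : hom B (F xi) :=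
  sigma xi ∘ iota2.

(* [bar] is the factorization of [f, g] through [sigma], denoted by an overline;
   [bar01] is the overlined [0 1]. *)
Lemma bar_eq (B X D : C) (xi : Action B X) (f : hom X D) (g : hom B D) :
  [f, g] ∘ flat_k = f ∘ xi ->
  [f, g] ∘ [flat_k, iota2] = [f, g] ∘ (xi ⊔m id B).
Proof.
intros H. now rewrite comp_copair, copair_map, H, copair_iota2, comp_id_r.
Qed.

Definition bar (B X D : C) (xi : Action B X) (f : hom X D) (g : hom B D)
    (H : [f, g] ∘ flat_k = f ∘ xi) : hom (F xi) D :=
  F_desc (bar_eq H).

Lemma bar_sigma (B X D : C) (xi : Action B X) (f : hom X D) (g : hom B D)
    (H : [f, g] ∘ flat_k = f ∘ xi) : bar H ∘ sigma xi = [f, g].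
Proof. apply F_desc_sigma. Qed.

Lemma zero_one_eq (B X : C) (xi : Action B X) :
  [zero X B, id B] ∘ flat_k = zero X B ∘ xi.
Proof. now rewrite flat_k_zero, zero_comp. Qed.

Definition bar01 (B X : C) (xi : Action B X) : hom (F xi) B :=
  bar (zero_one_eq xi).

Lemma bar01_split (B X : C) (xi : Action B X) :
  bar01 xi ∘ sigma_iota2 xi = id B.
Proof.
unfold bar01, sigma_iota2.
now rewrite comp_assoc, bar_sigma, copair_iota2.
Qed.

Lemma F_map_eq (B X B' X' : C) (xi : Action B X) (xi' : Action B' X')
    (f : hom X X') (g : hom B B') :
  is_act_hom xi xi' f g ->
  (sigma xi' ∘ (f ⊔m g)) ∘ [flat_k, iota2]
  = (sigma xi' ∘ (f ⊔m g)) ∘ (xi ⊔m id B).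
Proof.
unfold is_act_hom. intros H.
assert (E : (f ⊔m g) ∘ [flat_k, iota2]
            = [flat_k, iota2] ∘ ((g ♭m f) ⊔m g)).
{ rewrite comp_copair, copair_map, flat_k_map.
  unfold coprod_map at 2. now rewrite copair_iota2. }
rewrite <- !comp_assoc, E, comp_assoc, sigma_eq, <- comp_assoc.
now rewrite <- !coprod_map_comp, H, comp_id_l, comp_id_r.
Qed.

Definition F_map (B X B' X' : C) (xi : Action B X) (xi' : Action B' X')
    (f : hom X X') (g : hom B B') (H : is_act_hom xi xi' f g)
  : hom (F xi) (F xi') := F_desc (F_map_eq H).

Lemma F_map_sigma (B X B' X' : C) (xi : Action B X) (xi' : Action B' X')
    (f : hom X X') (g : hom B B') (H : is_act_hom xi xi' f g) :
  F_map H ∘ sigma xi = sigma xi' ∘ (f ⊔m g).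
Proof. apply F_desc_sigma. Qed.

Lemma F_map_id (B X : C) (xi : Action B X)
    (H : is_act_hom xi xi (id X) (id B)) : F_map H = id (F xi).
Proof.
apply F_ext. now rewrite F_map_sigma, coprod_map_id, comp_id_l, comp_id_r.
Qed.

Lemma F_map_comp (B X B' X' B'' X'' : C) (xi : Action B X)
    (xi' : Action B' X') (xi'' : Action B'' X'')
    (f : hom X X') (g : hom B B') (f' : hom X' X'') (g' : hom B' B'')
    (H : is_act_hom xi xi' f g) (H' : is_act_hom xi' xi'' f' g')
    (H'' : is_act_hom xi xi'' (f' ∘ f) (g' ∘ g)) :
  F_map H'' = F_map H' ∘ F_map H.
Proof.
apply F_ext.
rewrite F_map_sigma, <- comp_assoc, F_map_sigma, comp_assoc, F_map_sigma.
now rewrite coprod_map_comp, comp_assoc.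
Qed.

Definition T_obj (A : Act) : Pt C :=
  {| pt_A := F (ao_xi A); pt_B := ao_B A;
     pt_alpha := bar01 (ao_xi A); pt_beta := sigma_iota2 (ao_xi A);
     pt_split := bar01_split (ao_xi A) |}.

Lemma T_map_alpha (A A' : ActionObj) (f : ActionHom A A') :
  bar01 (ao_xi A') ∘ F_map (ah_xi f) = ah_B f ∘ bar01 (ao_xi A).
Proof.
apply F_ext. unfold bar01.
rewrite <- comp_assoc, F_map_sigma, comp_assoc, bar_sigma, copair_map.
rewrite <- comp_assoc, bar_sigma, comp_copair.
now rewrite zero_comp, comp_zero, comp_id_l, comp_id_r.
Qed.

Lemma T_map_beta (A A' : ActionObj) (f : ActionHom A A') :
  F_map (ah_xi f) ∘ sigma_iota2 (ao_xi A) = sigma_iota2 (ao_xi A') ∘ ah_B f.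
Proof.
unfold sigma_iota2. rewrite comp_assoc, F_map_sigma, <- !comp_assoc.
unfold coprod_map. now rewrite copair_iota2.
Qed.

Definition T_map (A A' : Act) (f : hom A A') : hom (T_obj A) (T_obj A') :=
  {| pth_1 := F_map (ah_xi f) : hom (pt_A (T_obj A)) (pt_A (T_obj A'));
     pth_0 := ah_B f : hom (pt_B (T_obj A)) (pt_B (T_obj A'));
     pth_alpha := T_map_alpha f;
     pth_beta := T_map_beta f |}.

Definition T : Functor Act (Pt C).
Proof.
refine {| fobj := T_obj; fmap := T_map |}.
- intros A. apply PointHom_eq; simpl; [apply F_map_id | reflexivity].
- intros A A' A'' g f.
  apply PointHom_eq; simpl; [apply F_map_comp | reflexivity].
Defined.

Record PreXModObj := {
  px_X : C;
  px_B : C;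
  px_h : hom px_X px_B;
  px_xi : Action px_B px_X;
  px_eq : [px_h, id px_B] ∘ flat_k = px_h ∘ px_xi
}.

Record PreXModHom (P Q : PreXModObj) := {
  pxh_X : hom (px_X P) (px_X Q);
  pxh_B : hom (px_B P) (px_B Q);
  pxh_act : is_act_hom (px_xi P) (px_xi Q) pxh_X pxh_B;
  pxh_h : px_h Q ∘ pxh_X = pxh_B ∘ px_h P
}.

Lemma PreXModHom_eq (P Q : PreXModObj) (f g : PreXModHom P Q) :
  pxh_X f = pxh_X g -> pxh_B f = pxh_B g -> f = g.
Proof.
destruct f, g; simpl; intros; subst; f_equal; apply proof_irrelevance.
Qed.

Definition PreXMod : Category.
Proof.
refine {| obj := PreXModObj;
  hom := PreXModHom;
  id := fun P => {| pxh_X := id (px_X P); pxh_B := id (px_B P);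
                    pxh_act := is_act_hom_id (px_xi P);
                    pxh_h := square_id (px_h P) |};
  comp := fun P Q R g f =>
    {| pxh_X := pxh_X g ∘ pxh_X f; pxh_B := pxh_B g ∘ pxh_B f;
       pxh_act := is_act_hom_comp (pxh_act f) (pxh_act g);
       pxh_h := square_comp (pxh_h f) (pxh_h g) |} |};
  intros; apply PreXModHom_eq; simpl;
  auto using comp_id_l, comp_id_r, comp_assoc.
Defined.

(* [tc_eq_bar] and [tc_eq_sigma] say that [bar01 tc_xiZ], with [bar tc_eq_h], and
   [sigma_iota2 tc_xiZ], with [sigma_iota2 tc_xiX], are morphisms of actions. *)
Record TwoChainObj := {
  tc_Z : C;
  tc_X : C;
  tc_B : C;
  tc_t : hom tc_Z tc_X;
  tc_h : hom tc_X tc_B;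
  tc_ht : tc_h ∘ tc_t = zero tc_Z tc_B;
  tc_xiX : Action tc_B tc_X;
  tc_xiZ : Action tc_X tc_Z;
  tc_xiF : Action (F tc_xiX) (F tc_xiZ);
  tc_eq_h : [tc_h, id tc_B] ∘ flat_k = tc_h ∘ tc_xiX;
  tc_eq_t : [tc_t, id tc_X] ∘ flat_k = tc_t ∘ tc_xiZ;
  tc_eq_F :
    [sigma_iota1 tc_xiX ∘ bar tc_eq_t, id (F tc_xiX)] ∘ flat_k
    = (sigma_iota1 tc_xiX ∘ bar tc_eq_t) ∘ tc_xiF;
  tc_eq_bar : bar01 tc_xiZ ∘ tc_xiF = tc_xiX ∘ (bar tc_eq_h ♭m bar01 tc_xiZ);
  tc_eq_sigma :
    sigma_iota2 tc_xiZ ∘ tc_xiX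
    = tc_xiF ∘ (sigma_iota2 tc_xiX ♭m sigma_iota2 tc_xiZ)
}.

Record TwoChainHom (P Q : TwoChainObj) := {
  tch_Z : hom (tc_Z P) (tc_Z Q);
  tch_X : hom (tc_X P) (tc_X Q);
  tch_B : hom (tc_B P) (tc_B Q);
  tch_t : tc_t Q ∘ tch_Z = tch_X ∘ tc_t P;
  tch_h : tc_h Q ∘ tch_X = tch_B ∘ tc_h P;
  tch_actX : is_act_hom (tc_xiX P) (tc_xiX Q) tch_X tch_B;
  tch_actZ : is_act_hom (tc_xiZ P) (tc_xiZ Q) tch_Z tch_X;
  tch_actF :
    is_act_hom (tc_xiF P) (tc_xiF Q) (F_map tch_actZ) (F_map tch_actX)
}.

Lemma TwoChainHom_eq (P Q : TwoChainObj) (f g : TwoChainHom P Q) :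
  tch_Z f = tch_Z g -> tch_X f = tch_X g -> tch_B f = tch_B g -> f = g.
Proof.
destruct f as [fZ fX fB ft fh fa fb fc], g as [gZ gX gB gt gh ga gb gc].
simpl. intros; subst.
rewrite (proof_irrelevance _ gt ft), (proof_irrelevance _ gh fh).
revert gc.
rewrite (proof_irrelevance _ ga fa), (proof_irrelevance _ gb fb).
intros gc. now rewrite (proof_irrelevance _ gc fc).
Qed.

Lemma TwoChainHom_id_actF (P : TwoChainObj) :
  is_act_hom (tc_xiF P) (tc_xiF P)
    (F_map (is_act_hom_id (tc_xiZ P))) (F_map (is_act_hom_id (tc_xiX P))).
Proof. rewrite !F_map_id. apply is_act_hom_id. Qed.

Lemma TwoChainHom_comp_actF (P Q R : TwoChainObj)
    (g : TwoChainHom Q R) (f : TwoChainHom P Q) :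
  is_act_hom (tc_xiF P) (tc_xiF R)
    (F_map (is_act_hom_comp (tch_actZ f) (tch_actZ g)))
    (F_map (is_act_hom_comp (tch_actX f) (tch_actX g))).
Proof.
rewrite (F_map_comp (tch_actZ f) (tch_actZ g)).
rewrite (F_map_comp (tch_actX f) (tch_actX g)).
exact (is_act_hom_comp (tch_actF f) (tch_actF g)).
Qed.

Definition TwoChainComp : Category.
Proof.
refine {| obj := TwoChainObj;
  hom := TwoChainHom;
  id := fun P =>
    {| tch_Z := id (tc_Z P); tch_X := id (tc_X P); tch_B := id (tc_B P);
       tch_t := square_id (tc_t P);
       tch_h := square_id (tc_h P);
       tch_actX := is_act_hom_id (tc_xiX P);
       tch_actZ := is_act_hom_id (tc_xiZ P);
       tch_actF := TwoChainHom_id_actF P |};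
  comp := fun P Q R g f =>
    {| tch_Z := tch_Z g ∘ tch_Z f; tch_X := tch_X g ∘ tch_X f;
       tch_B := tch_B g ∘ tch_B f;
       tch_t := square_comp (tch_t f) (tch_t g);
       tch_h := square_comp (tch_h f) (tch_h g);
       tch_actX := is_act_hom_comp (tch_actX f) (tch_actX g);
       tch_actZ := is_act_hom_comp (tch_actZ f) (tch_actZ g);
       tch_actF := TwoChainHom_comp_actF g f |} |};
  intros; apply TwoChainHom_eq; simpl;
  auto using comp_id_l, comp_id_r, comp_assoc.
Defined.

End InternalActions.

(* Main.v *)
From Stdlib Require Import ClassicalEpsilon.
Require Import Defs.

(* Since [T] is fully faithful, applying fullness to the free action [B ♭ D]
   shows that [σι1 : X -> F xi] is a kernel of [bar01 xi].  A reflexive graph is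
   a point [(C1, d, e)] over [C0], hence some [F xi], together with
   [c : F xi -> C0] splitting [σι2], i.e. [c = bar] of a pair [h, 1].  A split
   square is a point in the category of points, hence a point in the category of
   actions, which is an action of [F xiX] on [F xiZ] satisfying the last two
   equations of a 2-chain complex.  Finally [m : F xiF -> F xiX] is determined by
   [m σι1], because [m e2 = 1]; by [d m = d pi2] it lands in the kernel [σι1] of
   [d], so [m σι1 = σι1 w], and [m e1 = 1] gives [w σι2 = 1], i.e. [w = bar] of a
   pair [t, 1], while [c m = c pi1] means [h t = 0]. *)

(** * Equivalences as full, faithful and essentially surjective functors; componentwise
    isomorphisms *)

Section Equivalences.

Set Implicit Arguments.
Unset Strict Implicit.
Local Open Scope cat_scope.

Definition full (C D : Category) (F : Functor C D) : Prop :=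
  forall (X Y : C) (g : hom (F X) (F Y)), exists f : hom X Y, fmap F f = g.

Definition faithful (C D : Category) (F : Functor C D) : Prop :=
  forall (X Y : C) (f f' : hom X Y), fmap F f = fmap F f' -> f = f'.

Definition essentially_surjective (C D : Category) (F : Functor C D) : Prop :=
  forall Y : D, exists (X : C) (f : hom (F X) Y), is_iso f.

Lemma equivalence_inverse (C D : Category) (F : Functor C D) :
  is_equivalence F ->
  exists G : Functor D C,
    is_equivalence G /\ naturally_isomorphic (comp_functor G F) (id_functor C).
Proof.
intros [G [H1 H2]]. exists G. split; [exists F; now split | exact H1].
Qed.

Lemma equivalence_faithful (C D : Category) (F : Functor C D) :
  is_equivalence F -> faithful F.
Proof.
intros [G [[eta [nat iso]] _]] X Y f f' E. simpl in nat.
destruct (iso X) as [inv [_ Hinv]]. simpl in Hinv.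
rewrite <- (comp_id_r f), <- (comp_id_r f'), <- Hinv, !comp_assoc.
simpl. now rewrite !nat, E.
Qed.

(** The preimage of [g] is [fmap G g] conjugated by the isomorphism [G F ≅ 1]. That [F] sends it to
    [g] is checked after applying [G], which is itself an equivalence and hence faithful. *)
Lemma equivalence_full (C D : Category) (F : Functor C D) :
  is_equivalence F -> full F.
Proof.
intros HF X Y g.
destruct (equivalence_inverse HF) as [G [HG [eta [nat iso]]]]. simpl in nat.
destruct (iso X) as [invX [HX1 HX2]]. destruct (iso Y) as [invY [HY1 HY2]].
exists (eta Y ∘ fmap G g ∘ invX).
apply (equivalence_faithful HG). simpl in *.
rewrite <- (comp_id_l (fmap G (fmap F _))), <- HY1, <- comp_assoc, <- nat.
rewrite <- !comp_assoc, HX1, comp_id_r, comp_assoc, HY1.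
apply comp_id_l.
Qed.

Lemma equivalence_essentially_surjective (C D : Category) (F : Functor C D) :
  is_equivalence F -> essentially_surjective F.
Proof.
intros [G [_ [eta [nat iso]]]] Y. exists (G Y), (eta Y). apply iso.
Qed.

(** The inverse functor takes chosen preimages of objects and of morphisms conjugated by the chosen
    isomorphisms; faithfulness makes these choices functorial and natural. *)
Lemma equivalence_criterion (C D : Category) (F : Functor C D) :
  full F -> faithful F -> essentially_surjective F -> is_equivalence F.
Proof.
intros Hfull Hfaith Hes.
pose (obG := fun Y => proj1_sig (constructive_indefinite_description _ (Hes Y))).
(* The isomorphism and its inverse are chosen as one pair, so that both inverse laws concern the
   same choice. *)
assert (Heps : forall Y, exists p : hom (F (obG Y)) Y * hom Y (F (obG Y)),
  snd p ∘ fst p = id _ /\ fst p ∘ snd p = id _).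
{ intros Y. unfold obG.
  destruct (constructive_indefinite_description _ (Hes Y)) as [X [f [g Hg]]].
  now exists (f, g). }
pose (eps := fun Y => fst (proj1_sig (constructive_indefinite_description _ (Heps Y)))).
pose (inv := fun Y => snd (proj1_sig (constructive_indefinite_description _ (Heps Y)))).
assert (inv_eps : forall Y, inv Y ∘ eps Y = id _).
{ intros Y. exact (proj1 (proj2_sig
    (constructive_indefinite_description _ (Heps Y)))). }
assert (eps_inv : forall Y, eps Y ∘ inv Y = id _).
{ intros Y. exact (proj2 (proj2_sig
    (constructive_indefinite_description _ (Heps Y)))). }
clearbody eps inv. clear Heps.
pose (lift := fun X Y g => proj1_sig
  (constructive_indefinite_description _ (Hfull X Y g))).
assert (F_lift : forall X Y g, fmap F (lift X Y g) = g).
{ intros X Y g. exact (proj2_sig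
    (constructive_indefinite_description _ (Hfull X Y g))). }
clearbody lift.
unshelve eexists.
{ refine {| fobj := obG; fmap := fun Y Y' g => lift _ _ (inv Y' ∘ g ∘ eps Y) |}.
  - intros Y. apply Hfaith. now rewrite F_lift, comp_id_r, inv_eps, fmap_id.
  - intros Y Y' Y'' g f. apply Hfaith. rewrite fmap_comp, !F_lift.
    rewrite !comp_assoc, <- (comp_assoc _ (eps Y') (inv Y')), eps_inv.
    now rewrite comp_id_r. }
split.
- exists (fun X => lift _ _ (eps (F X))). simpl. split.
  + intros X Y f. apply Hfaith.
    now rewrite !fmap_comp, !F_lift, !comp_assoc, eps_inv, comp_id_l.
  + intros X. exists (lift _ _ (inv (F X))).
    split; apply Hfaith; now rewrite fmap_comp, !F_lift, fmap_id.
- exists eps. simpl. split.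
  + intros X Y f. now rewrite F_lift, !comp_assoc, eps_inv, comp_id_l.
  + intros Y. now exists (inv Y).
Qed.

(** The functors built below go from action data to graphs, opposite to the equivalences claimed;
    their inverses exist only by choice. *)
Lemma equivalent_from_functor (C D : Category) (F : Functor D C) :
  full F -> faithful F -> essentially_surjective F -> equivalent_categories C D.
Proof.
intros H1 H2 H3.
destruct (equivalence_inverse (equivalence_criterion H1 H2 H3)) as [G [HG _]].
now exists G.
Qed.

(** Applied to each structure map in turn, this makes componentwise inverses a morphism of graphs or
    of precategories. *)
Lemma inverse_square (C : Category) (X Y X' Y' : C) (b : hom X Y)
    (b' : hom X' Y') (p : hom X X') (p' : hom X' X) (q : hom Y Y')
    (q' : hom Y' Y) :
  p ∘ p' = id X' -> q' ∘ q = id Y -> b' ∘ p = q ∘ b -> b ∘ p' = q' ∘ b'.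
Proof.
intros Hp Hq H.
rewrite <- (comp_id_l (b ∘ p')), <- Hq, <- comp_assoc, (comp_assoc q), <- H.
now rewrite <- (comp_assoc b'), Hp, comp_id_r.
Qed.

Lemma RG_iso (C : Category) (G H : RG C) (f : hom G H) :
  is_iso (rgh_1 f) -> is_iso (rgh_0 f) -> is_iso f.
Proof.
intros [g1 [L1 R1]] [g0 [L0 R0]]. unshelve eexists.
{ refine {| rgh_1 := g1; rgh_0 := g0 |}.
  - exact (inverse_square R1 L0 (rgh_d f)).
  - exact (inverse_square R1 L0 (rgh_c f)).
  - exact (inverse_square R0 L1 (rgh_e f)). }
split; now apply ReflexiveGraphHom_eq.
Qed.

Lemma PC_iso (C : Category) (P Q : PC C) (f : hom P Q) :
  is_iso (pch_2 f) -> is_iso (pch_1 f) -> is_iso (pch_0 f) -> is_iso f.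
Proof.
intros [g2 [L2 R2]] [g1 [L1 R1]] [g0 [L0 R0]]. unshelve eexists.
{ refine {| pch_2 := g2; pch_1 := g1; pch_0 := g0 |}.
  - exact (inverse_square R2 L1 (pch_pi1 f)).
  - exact (inverse_square R2 L1 (pch_pi2 f)).
  - exact (inverse_square R2 L1 (pch_m f)).
  - exact (inverse_square R1 L2 (pch_e1 f)).
  - exact (inverse_square R1 L2 (pch_e2 f)).
  - exact (inverse_square R1 L0 (pch_d f)).
  - exact (inverse_square R1 L0 (pch_c f)).
  - exact (inverse_square R0 L1 (pch_e f)). }
split; now apply PrecategoryHom_eq.
Qed.

End Equivalences.

Section InternalActions.

Set Implicit Arguments.
Unset Strict Implicit.
Local Open Scope cat_scope.

Context (C : PointedCategory).
Context (coprods : BinaryCoproducts C).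
Context (kers : SplitEpiKernels C).
Context (coeqs : ReflexiveCoequalizers C).

Local Notation "X ⊔ Y" := (coprod_obj (coprods X Y))
  (at level 50, left associativity).
Local Notation "[ f , g ]" := (copair (coprods _ _) f g) (at level 0).
Local Notation "f ⊔m g" := (coprod_map coprods f g)
  (at level 50, left associativity).
Local Notation "B ♭ X" := (flat coprods kers B X)
  (at level 45, right associativity).
Local Notation "g ♭m f" := (flat_map coprods kers g f)
  (at level 45, right associativity).
Local Notation k := (flat_k coprods kers _ _).
Local Notation ι1 := (iota1 coprods _ _).
Local Notation ι2 := (iota2 coprods _ _).
Local Notation η := (flat_eta coprods kers _ _).
Local Notation μ := (flat_mu coprods kers _ _).
Local Notation Action := (Action coprods kers).
Local Notation F := (F coeqs).
Local Notation σι1 := (sigma_iota1 coeqs).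
Local Notation σι2 := (sigma_iota2 coeqs).
Local Notation bar01 := (bar01 coeqs).
Local Notation F_map := (F_map coeqs).
Local Notation bar := (bar coeqs).

(** * The monad [B ♭ -], its free algebras, and morphisms out of [F] *)

Lemma flat_k_mu (B X : C) : k ∘ flat_mu coprods kers B X = [k, ι2] ∘ k.
Proof. apply flat_k_lift. Qed.

Lemma coprod_map_iota1 (X X' Y Y' : C) (f : hom X X') (g : hom Y Y') :
  (f ⊔m g) ∘ ι1 = ι1 ∘ f.
Proof. apply copair_iota1. Qed.

Lemma flat_eta_natural (B B' X X' : C) (g : hom B B') (f : hom X X') :
  (g ♭m f) ∘ η = η ∘ f.
Proof.
apply flat_ext.
rewrite !comp_assoc, flat_k_map, <- comp_assoc, !flat_k_eta.
apply coprod_map_iota1.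
Qed.

Lemma flat_k_iota2_natural (B B' X X' : C) (g : hom B B') (f : hom X X') :
  [k, ι2] ∘ ((g ♭m f) ⊔m g) = (f ⊔m g) ∘ [k, ι2].
Proof.
rewrite copair_map, comp_copair, flat_k_map. unfold coprod_map at 3.
now rewrite copair_iota2.
Qed.

Lemma flat_mu_natural (B B' X X' : C) (g : hom B B') (f : hom X X') :
  (g ♭m f) ∘ μ = μ ∘ (g ♭m (g ♭m f)).
Proof.
apply flat_ext.
rewrite !comp_assoc, flat_k_map, flat_k_mu, <- !comp_assoc, flat_k_map.
now rewrite flat_k_mu, !comp_assoc, flat_k_iota2_natural.
Qed.

Lemma flat_mu_eta (B X : C) : μ ∘ η = id (B ♭ X).
Proof.
apply flat_ext.
now rewrite comp_assoc, flat_k_mu, <- comp_assoc, flat_k_eta, copair_iota1,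
  comp_id_r.
Qed.

Lemma flat_mu_assoc (B X : C) :
  μ ∘ μ = flat_mu coprods kers B X ∘ (id B ♭m μ).
Proof.
apply flat_ext.
rewrite !comp_assoc, !flat_k_mu, <- !comp_assoc, flat_k_mu, flat_k_map.
rewrite !comp_assoc, copair_map, flat_k_mu, comp_copair, copair_iota2.
now rewrite comp_id_r.
Qed.

Definition free_action (B X : C) : Action B (B ♭ X) :=
  {| act_map := μ;
     act_eta := flat_mu_eta B X;
     act_mu := flat_mu_assoc B X |}.

Lemma F_ext2 (B X : C) (xi : Action B X) (D : C) (u v : hom (F xi) D) :
  u ∘ σι1 xi = v ∘ σι1 xi -> u ∘ σι2 xi = v ∘ σι2 xi -> u = v.
Proof.
unfold sigma_iota1, sigma_iota2. rewrite !comp_assoc. intros H1 H2.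
apply F_ext. now apply coprod_ext.
Qed.

Lemma bar_iota1 (B X D : C) (xi : Action B X) (f : hom X D) (g : hom B D)
    (H : [f, g] ∘ k = f ∘ xi) : bar H ∘ σι1 xi = f.
Proof.
unfold sigma_iota1. now rewrite comp_assoc, bar_sigma, copair_iota1.
Qed.

Lemma bar_iota2 (B X D : C) (xi : Action B X) (f : hom X D) (g : hom B D)
    (H : [f, g] ∘ k = f ∘ xi) : bar H ∘ σι2 xi = g.
Proof.
unfold sigma_iota2. now rewrite comp_assoc, bar_sigma, copair_iota2.
Qed.

Lemma bar01_iota1 (B X : C) (xi : Action B X) : bar01 xi ∘ σι1 xi = zero X B.
Proof. apply bar_iota1. Qed.

Lemma F_map_iota1 (B X B' X' : C) (xi : Action B X) (xi' : Action B' X')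
    (f : hom X X') (g : hom B B') (H : is_act_hom xi xi' f g) :
  F_map H ∘ σι1 xi = σι1 xi' ∘ f.
Proof.
unfold sigma_iota1.
now rewrite comp_assoc, F_map_sigma, <- !comp_assoc, coprod_map_iota1.
Qed.

Lemma F_map_iota2 (B X B' X' : C) (xi : Action B X) (xi' : Action B' X')
    (f : hom X X') (g : hom B B') (H : is_act_hom xi xi' f g) :
  F_map H ∘ σι2 xi = σι2 xi' ∘ g.
Proof. exact (T_map_beta coeqs (Build_ActionHom
  (A := {| ao_xi := xi |}) (A' := {| ao_xi := xi' |}) H)). Qed.

Lemma bar01_F_map (B X B' X' : C) (xi : Action B X) (xi' : Action B' X')
    (f : hom X X') (g : hom B B') (H : is_act_hom xi xi' f g) :
  bar01 xi' ∘ F_map H = g ∘ bar01 xi.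
Proof. exact (T_map_alpha coeqs (Build_ActionHom
  (A := {| ao_xi := xi |}) (A' := {| ao_xi := xi' |}) H)). Qed.

(** The pair [[σι1, σι2]] is [sigma] itself, and the coequalizer equation precomposed with [ι1]
    reads [sigma k = sigma ι1 xi]. *)
Lemma sigma_iota1_act (B X : C) (xi : Action B X) :
  [σι1 xi, σι2 xi] ∘ k = σι1 xi ∘ xi.
Proof.
unfold sigma_iota1, sigma_iota2.
assert (E := sigma_eq coeqs xi).
rewrite <- comp_copair.
replace [ι1, ι2] with (id (X ⊔ B)).
2: { apply coprod_ext; now rewrite comp_id_l, ?copair_iota1, ?copair_iota2. }
rewrite comp_id_r.
rewrite <- (copair_iota1 coprods k (iota2 coprods X B)), comp_assoc, E.
now rewrite <- !comp_assoc, coprod_map_iota1.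
Qed.

(** Every morphism out of [F xi] thus satisfies the condition for a [bar]. When [u ∘ σι2 xi] is an
    identity, this is the equation required of [h], of [t] and of the composition. *)
Lemma bar_restrict (B X D : C) (xi : Action B X) (u : hom (F xi) D) :
  [u ∘ σι1 xi, u ∘ σι2 xi] ∘ k = (u ∘ σι1 xi) ∘ xi.
Proof.
now rewrite <- comp_copair, <- !comp_assoc, sigma_iota1_act.
Qed.

(** The conjugate of [xi] is an action by naturality of [η] and [μ]. This replaces objects known up
    to isomorphism by prescribed ones. *)
Lemma action_transport (B X B' X' : C) (xi : Action B X) (f : hom X X')
    (f' : hom X' X) (g : hom B B') (g' : hom B' B) :
  f ∘ f' = id X' -> f' ∘ f = id X -> g ∘ g' = id B' -> g' ∘ g = id B ->
  exists xi' : Action B' X',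
    is_act_hom xi xi' f g /\ is_act_hom xi' xi f' g'.
Proof.
intros Hf Hf' Hg Hg'. unshelve eexists.
{ refine {| act_map := f ∘ xi ∘ (g' ♭m f') |}.
  - rewrite <- !comp_assoc, flat_eta_natural, (comp_assoc xi), act_eta.
    now rewrite comp_id_l.
  - rewrite <- !comp_assoc, flat_mu_natural, (comp_assoc xi), act_mu.
    rewrite <- !flat_map_comp, <- !comp_assoc, <- flat_map_comp.
    rewrite comp_id_l, comp_id_r, !(comp_assoc f' f), Hf', comp_id_l.
    reflexivity. }
split; unfold is_act_hom; simpl.
- now rewrite <- comp_assoc, <- flat_map_comp, Hf', Hg', flat_map_id, comp_id_r.
- now rewrite !comp_assoc, Hf', comp_id_l.
Qed.

(* In left-associated composites a redex [a ∘ b] may be hidden in [h ∘ a ∘ b],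
   hence the second group of rules. *)
Ltac F_simpl := simpl; repeat first
  [ rewrite comp_assoc | rewrite comp_id_l | rewrite comp_id_r
  | rewrite bar_iota1 | rewrite bar_iota2 | rewrite bar01_iota1
  | rewrite bar01_split | rewrite F_map_iota1 | rewrite F_map_iota2
  | rewrite bar01_F_map | rewrite zero_comp | rewrite comp_zero
  | rewrite <- (comp_assoc _ (bar _) (σι1 _)), bar_iota1
  | rewrite <- (comp_assoc _ (bar _) (σι2 _)), bar_iota2
  | rewrite <- (comp_assoc _ (bar01 _) (σι1 _)), bar01_iota1
  | rewrite <- (comp_assoc _ (bar01 _) (σι2 _)), bar01_split
  | rewrite <- (comp_assoc _ (F_map _) (σι1 _)), F_map_iota1
  | rewrite <- (comp_assoc _ (F_map _) (σι2 _)), F_map_iota2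
  | rewrite <- (comp_assoc _ (bar01 _) (F_map _)), bar01_F_map ].

Lemma bar_F_map (B X B' X' D D' : C) (xi : Action B X) (xi' : Action B' X')
    (f : hom X X') (g : hom B B') (h : hom X D) (l : hom B D)
    (h' : hom X' D') (l' : hom B' D') (w : hom D D')
    (H : is_act_hom xi xi' f g)
    (E : [h, l] ∘ k = h ∘ xi) (E' : [h', l'] ∘ k = h' ∘ xi') :
  h' ∘ f = w ∘ h -> l' ∘ g = w ∘ l -> bar E' ∘ F_map H = w ∘ bar E.
Proof.
intros Hf Hg. apply F_ext2; F_simpl; assumption.
Qed.

(** * The functors to reflexive graphs and to precategories *)

Definition graph_of_PreXMod (P : PreXMod coprods kers) : ReflexiveGraph C :=
  {| rg_1 := F (px_xi P); rg_0 := px_B P;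
     rg_d := bar01 (px_xi P); rg_c := bar (px_eq P); rg_e := σι2 (px_xi P);
     rg_de := bar01_split coeqs (px_xi P); rg_ce := bar_iota2 (px_eq P) |}.

Definition PreXMod_to_RG : Functor (PreXMod coprods kers) (RG C).
Proof.
refine {| fobj := graph_of_PreXMod : _ -> RG C;
  fmap := fun P Q f =>
    {| rgh_1 := F_map (pxh_act f)
         : hom (rg_1 (graph_of_PreXMod P)) (rg_1 (graph_of_PreXMod Q));
       rgh_0 := pxh_B f
         : hom (rg_0 (graph_of_PreXMod P)) (rg_0 (graph_of_PreXMod Q));
       rgh_d := bar01_F_map (pxh_act f);
       rgh_c := bar_F_map (pxh_act f) (px_eq P) (px_eq Q) (pxh_h f)
                  (eq_sym (square_id (pxh_B f)));
       rgh_e := eq_sym (F_map_iota2 (pxh_act f)) |} |}.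
- intros P. apply ReflexiveGraphHom_eq; simpl; [apply F_map_id | reflexivity].
- intros P Q R g f.
  apply ReflexiveGraphHom_eq; simpl; [apply F_map_comp | reflexivity].
Defined.

Section Precategory.

Context (P : TwoChainObj coprods kers coeqs).

Definition chain_pi1 : hom (F (tc_xiF P)) (F (tc_xiX P)) :=
  F_map (eq_sym (tc_eq_bar P)
    : is_act_hom (tc_xiF P) (tc_xiX P) (bar01 (tc_xiZ P)) (bar (tc_eq_h P))).

Definition chain_e1 : hom (F (tc_xiX P)) (F (tc_xiF P)) :=
  F_map (eq_sym (tc_eq_sigma P)
    : is_act_hom (tc_xiX P) (tc_xiF P) (σι2 (tc_xiZ P)) (σι2 (tc_xiX P))).

Definition precategory_of_chain : Precategory C.
Proof.
refine {| pc_2 := F (tc_xiF P); pc_1 := F (tc_xiX P); pc_0 := tc_B P;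
  pc_pi1 := chain_pi1; pc_pi2 := bar01 (tc_xiF P); pc_m := bar (tc_eq_F P);
  pc_e1 := chain_e1; pc_e2 := σι2 (tc_xiF P);
  pc_d := bar01 (tc_xiX P); pc_c := bar (tc_eq_h P); pc_e := σι2 (tc_xiX P) |};
(* The axioms are checked on [σι1] and [σι2]. The condition [h t = 0] enters in [c m = c pi1], whose
   sides restrict on [Z] to [h t] and [0]. *)
abstract (unfold chain_pi1, chain_e1;
  first [now F_simpl
        |repeat (apply F_ext2; F_simpl); first [reflexivity | apply tc_ht]]).
Defined.

End Precategory.

Definition TwoChainComp_to_PC : Functor (TwoChainComp coprods kers coeqs) (PC C).
Proof.
unshelve eexists.
- exact precategory_of_chain.
- intros P Q f.
  refine {| pch_2 := F_map (tch_actF f)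
      : hom (pc_2 (precategory_of_chain P)) (pc_2 (precategory_of_chain Q));
    pch_1 := F_map (tch_actX f)
      : hom (pc_1 (precategory_of_chain P)) (pc_1 (precategory_of_chain Q));
    pch_0 := tch_B f
      : hom (pc_0 (precategory_of_chain P)) (pc_0 (precategory_of_chain Q)) |};
  abstract (simpl; unfold chain_pi1, chain_e1;
    first [now F_simpl
          |repeat (apply F_ext2; F_simpl);
           now rewrite <- ?comp_assoc, ?(tch_t f), ?(tch_h f)]).
- abstract (intros P;
    apply PrecategoryHom_eq; simpl; [|apply F_map_id | reflexivity];
    (* The components of this [F_map] are themselves [F_map]s of identities, so [F_map_id] applies
       only after restriction to [σι1] and [σι2]. *)
    apply F_ext2; F_simpl; now rewrite F_map_id, comp_id_r).
- abstract (intros P Q R g f;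
    assert (EX := F_map_comp coeqs (tch_actX f) (tch_actX g));
    assert (EZ := F_map_comp coeqs (tch_actZ f) (tch_actZ g));
    apply PrecategoryHom_eq; simpl; [|apply EX | reflexivity];
    apply F_ext2; F_simpl; rewrite ?EX, ?EZ; now rewrite comp_assoc).
Defined.

(** * Consequences of [T] being an equivalence: lifting morphisms and points, and [σι1] as a
    kernel *)

Section Reconstruction.

Context (HT : is_equivalence (T coprods kers coeqs)).

Lemma F_map_faithful (B X B' X' : C) (xi : Action B X) (xi' : Action B' X')
    (f f' : hom X X') (g g' : hom B B') (H : is_act_hom xi xi' f g)
    (H' : is_act_hom xi xi' f' g') :
  F_map H = F_map H' -> g = g' -> f = f'.
Proof.
intros E Eg.
pose (A := {| ao_xi := xi |} : Act coprods kers).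
pose (A' := {| ao_xi := xi' |} : Act coprods kers).
assert (E' := equivalence_faithful HT (X := A) (Y := A')
  (f := Build_ActionHom (A := A) (A' := A') H)
  (f' := Build_ActionHom (A := A) (A' := A') H')
  (PointHom_eq (f := T_map coeqs (Build_ActionHom (A := A) (A' := A') H))
    (g := T_map coeqs (Build_ActionHom (A := A) (A' := A') H')) E Eg)).
exact (f_equal (@ah_X _ _ _ _ _) E').
Qed.

(** The two equations make [(u, g)] a morphism of points. Since [T] leaves base components
    unchanged, the preimage lies over [g] itself. *)
Lemma F_map_full (B X B' X' : C) (xi : Action B X) (xi' : Action B' X')
    (u : hom (F xi) (F xi')) (g : hom B B') :
  bar01 xi' ∘ u = g ∘ bar01 xi -> u ∘ σι2 xi = σι2 xi' ∘ g ->
  exists (f : hom X X') (H : is_act_hom xi xi' f g), F_map H = u.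
Proof.
intros E1 E2.
pose (A := {| ao_xi := xi |} : Act coprods kers).
pose (A' := {| ao_xi := xi' |} : Act coprods kers).
destruct (equivalence_full HT (X := A) (Y := A')
  ({| pth_1 := u : hom (pt_A (T_obj coeqs A)) (pt_A (T_obj coeqs A'));
      pth_0 := g : hom (pt_B (T_obj coeqs A)) (pt_B (T_obj coeqs A'));
      pth_alpha := E1; pth_beta := E2 |})) as [[f g0 H] E].
assert (Eu := f_equal (@pth_1 _ _ _) E).
assert (Eg := f_equal (@pth_0 _ _ _) E).
simpl in *. subst g0. now exists f, H.
Qed.

Lemma point_is_F (A B : C) (alpha : hom A B) (beta : hom B A) :
  alpha ∘ beta = id B ->
  exists (X : C) (xi : Action B X) (u : hom (F xi) A),
    is_iso u /\ alpha ∘ u = bar01 xi /\ u ∘ σι2 xi = beta.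
Proof.
intros split.
destruct (equivalence_essentially_surjective HT
  {| pt_alpha := alpha; pt_beta := beta; pt_split := split |})
  as [[X B0 xi0] [[u g Ea Eb] [[u' g' Ea' Eb'] [HL HR]]]].
assert (L1 := f_equal (@pth_1 _ _ _) HL). assert (L0 := f_equal (@pth_0 _ _ _) HL).
assert (R1 := f_equal (@pth_1 _ _ _) HR). assert (R0 := f_equal (@pth_0 _ _ _) HR).
simpl in *.
(* Essential surjectivity gives an action of some [B0] isomorphic to [B]; transport along [g] gives
   an action of [B] itself. *)
destruct (action_transport xi0 (comp_id_l (id X)) (comp_id_l (id X)) R0 L0)
  as [xi [H H']].
exists X, xi, (u ∘ F_map H'). repeat split.
- exists (F_map H ∘ u'). split.
  + rewrite !comp_assoc, <- (comp_assoc _ u'), L1. apply F_ext2; F_simpl.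
    * reflexivity.
    * now rewrite <- comp_assoc, R0, comp_id_r.
  + rewrite !comp_assoc, <- (comp_assoc u).
    replace (F_map H' ∘ F_map H) with (id (F xi0)); [now rewrite comp_id_r|].
    apply F_ext2; F_simpl; [reflexivity|].
    now rewrite <- comp_assoc, L0, comp_id_r.
- rewrite comp_assoc, Ea. F_simpl. now rewrite R0, comp_id_l.
- rewrite <- comp_assoc, F_map_iota2, comp_assoc, Eb, <- comp_assoc, R0.
  apply comp_id_r.
Qed.

(** A morphism [z : D -> X] extends to the action morphism [xi ∘ (id B ♭m z)] out of the free
    action, and [η] recovers [z] from it. The image of this extension under [F] depends on [z] only
    through [σι1 xi ∘ z], so faithfulness gives the claim. *)
Lemma sigma_iota1_mono (B X D : C) (xi : Action B X) (y y' : hom D X) :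
  σι1 xi ∘ y = σι1 xi ∘ y' -> y = y'.
Proof.
intros E.
assert (act : forall z : hom D X,
  is_act_hom (free_action B D) xi (xi ∘ (id B ♭m z)) (id B)).
{ intros z. unfold is_act_hom. simpl.
  rewrite <- (comp_id_l (id B)) at 1.
  rewrite flat_map_comp, comp_assoc, <- act_mu, <- !comp_assoc.
  now rewrite flat_mu_natural. }
assert (Ext : forall z : hom D X, σι1 xi ∘ (xi ∘ (id B ♭m z))
  = [σι1 xi ∘ z, σι2 xi] ∘ k).
{ intros z. rewrite comp_assoc, <- sigma_iota1_act, <- comp_assoc, flat_k_map.
  now rewrite comp_assoc, copair_map, comp_id_r. }
assert (Eta : forall z : hom D X, xi ∘ (id B ♭m z) ∘ η = z).
{ intros z. rewrite <- comp_assoc, flat_eta_natural, comp_assoc, act_eta.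
  apply comp_id_l. }
rewrite <- (Eta y), <- (Eta y'). f_equal.
apply (@F_map_faithful _ _ _ _ _ _ _ _ _ _ (act y) (act y')); [|reflexivity].
apply F_ext2; F_simpl; [|reflexivity].
now rewrite <- !comp_assoc, !Ext, E.
Qed.

(* A morphism [x] killed by [bar01 xi] amounts to a morphism of points
   [x, σι2] from [D ⊔ B]; precomposed with [F (free_action B D) -> D ⊔ B] it
   comes from a morphism of actions out of the free action, whose value on the
   generators [D] is the factorization. *)
Lemma sigma_iota1_kernel (B X D : C) (xi : Action B X) (x : hom D (F xi)) :
  bar01 xi ∘ x = zero D B -> exists y : hom D X, σι1 xi ∘ y = x.
Proof.
intros E.
assert (Ek : [k, iota2 coprods D B] ∘ k = k ∘ free_action B D).
{ symmetry. apply flat_k_mu. }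
destruct (@F_map_full _ _ _ _ (free_action B D) xi
  ([x, σι2 xi] ∘ bar Ek) (id B)) as [f [H Ef]].
- F_simpl. rewrite comp_copair, E, bar01_split.
  apply F_ext2; F_simpl.
  + now rewrite flat_k_zero.
  + now rewrite copair_iota2.
- F_simpl. apply copair_iota2.
- exists (f ∘ η). rewrite comp_assoc, <- (F_map_iota1 H), Ef.
  F_simpl. rewrite <- comp_assoc, flat_k_eta. apply copair_iota1.
Qed.

(** * Reflexive graphs and pre-crossed modules *)

Lemma PreXMod_to_RG_full : full PreXMod_to_RG.
Proof.
intros P Q [f1 f0 Hd Hc He]. simpl in *.
destruct (F_map_full Hd (eq_sym He)) as [f [H E]]. subst f1.
unshelve eexists.
{ refine {| pxh_X := f; pxh_B := f0; pxh_act := H |}.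
  (* Compatibility with [d] and [e] has produced [f]; compatibility with [c], restricted to [X], is
     the square for [h]. *)
  apply (f_equal (fun w => w ∘ σι1 (px_xi P))) in Hc.
  revert Hc. now F_simpl. }
now apply ReflexiveGraphHom_eq.
Qed.

Lemma PreXMod_to_RG_faithful : faithful PreXMod_to_RG.
Proof.
intros P Q f f' E.
assert (E1 := f_equal (@rgh_1 _ _ _) E). assert (E0 := f_equal (@rgh_0 _ _ _) E).
apply PreXModHom_eq; [exact (F_map_faithful E1 E0) | exact E0].
Qed.

Lemma PreXMod_to_RG_essentially_surjective :
  essentially_surjective PreXMod_to_RG.
Proof.
intros [C1 C0 d c e de ce].
destruct (point_is_F de) as [X [xi [u [iso [Ed Ee]]]]].
(* This is [c e = 1] carried along [u]; it makes [c ∘ u] the [bar] of its restriction to [X] and the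
   identity. *)
assert (Ec : (c ∘ u) ∘ σι2 xi = id C0) by now rewrite <- comp_assoc, Ee.
assert (Hh : [c ∘ u ∘ σι1 xi, id C0] ∘ k = (c ∘ u ∘ σι1 xi) ∘ xi).
{ rewrite <- Ec. apply bar_restrict. }
pose (P := {| px_xi := xi; px_eq := Hh |} : PreXMod coprods kers).
exists P.
unshelve eexists.
{ refine (@Build_ReflexiveGraphHom C (graph_of_PreXMod P)
    (Build_ReflexiveGraph de ce) u (id C0) _ _ _); simpl.
  - now rewrite comp_id_l.
  - rewrite comp_id_l. apply F_ext2; F_simpl; [reflexivity | exact Ec].
  - now rewrite comp_id_r. }
apply RG_iso; [exact iso | exists (id C0); split; apply comp_id_l].
Qed.

(** * Precategories and 2-chain complexes *)

Lemma TwoChainComp_to_PC_full : full TwoChainComp_to_PC.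
Proof.
intros P Q [f2 f1 f0 Hpi1 Hpi2 Hm He1 He2 Hd Hc He]. simpl in *.
unfold chain_pi1, chain_e1 in *.
destruct (F_map_full Hd (eq_sym He)) as [fX [HX EX]]. subst f1.
destruct (F_map_full Hpi2 (eq_sym He2)) as [fF [HF EF]]. subst f2.
(* Compatibility with [pi1] and [e1], restricted along [σι1] and cancelled by its monicity, makes
   [fF] a morphism of points over [fX], so fullness applies once more and yields [fZ]. *)
assert (E1 : bar01 (tc_xiZ Q) ∘ fF = fX ∘ bar01 (tc_xiZ P)).
{ apply (sigma_iota1_mono (xi := tc_xiX Q)).
  apply (f_equal (fun w => w ∘ σι1 (tc_xiF P))) in Hpi1.
  revert Hpi1. now F_simpl. }
assert (E2 : fF ∘ σι2 (tc_xiZ P) = σι2 (tc_xiZ Q) ∘ fX).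
{ apply (sigma_iota1_mono (xi := tc_xiF Q)).
  apply (f_equal (fun w => w ∘ σι1 (tc_xiX P))) in He1.
  revert He1. now F_simpl. }
destruct (F_map_full E1 E2) as [fZ [HZ EZ]]. subst fF.
unshelve eexists.
{ refine {| tch_Z := fZ; tch_X := fX; tch_B := f0; tch_actZ := HZ;
            tch_actX := HX; tch_actF := HF |}.
  - apply (sigma_iota1_mono (xi := tc_xiX Q)).
    apply (f_equal (fun w => w ∘ σι1 (tc_xiF P) ∘ σι1 (tc_xiZ P))) in Hm.
    revert Hm. now F_simpl.
  - apply (f_equal (fun w => w ∘ σι1 (tc_xiX P))) in Hc.
    revert Hc. now F_simpl. }
now apply PrecategoryHom_eq.
Qed.

Lemma TwoChainComp_to_PC_faithful : faithful TwoChainComp_to_PC.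
Proof.
intros P Q f f' E.
assert (E2 := f_equal (@pch_2 _ _ _) E). assert (E1 := f_equal (@pch_1 _ _ _) E).
assert (E0 := f_equal (@pch_0 _ _ _) E). simpl in *.
assert (EX := F_map_faithful E1 E0).
exact (TwoChainHom_eq (F_map_faithful (F_map_faithful E2 E1) EX) EX E0).
Qed.

(* The point [(C2, pi2, e2)] over [C1] and the point [(C1, d, e)] over [C0] come
   from actions on some [Y] and [X]; the rest of the split square makes [Y] a
   point over [X], so [Y] is [F xiZ] up to isomorphism. *)
Lemma split_square_is_F (B X A : C) (xiX : Action B X)
    (pi1 pi2 : hom A (F xiX)) (e1 e2 : hom (F xiX) A) (c : hom (F xiX) B) :
  pi2 ∘ e2 = id _ -> pi1 ∘ e1 = id _ -> c ∘ σι2 xiX = id B ->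
  bar01 xiX ∘ pi1 = c ∘ pi2 -> pi1 ∘ e2 = σι2 xiX ∘ c ->
  pi2 ∘ e1 = σι2 xiX ∘ bar01 xiX -> e1 ∘ σι2 xiX = e2 ∘ σι2 xiX ->
  exists (Z : C) (xiZ : Action X Z) (xiF : Action (F xiX) (F xiZ))
    (Hpi : is_act_hom xiF xiX (bar01 xiZ) c)
    (He : is_act_hom xiX xiF (σι2 xiZ) (σι2 xiX))
    (u : hom (F xiF) A),
    is_iso u /\ pi2 ∘ u = bar01 xiF /\ u ∘ σι2 xiF = e2 /\
    pi1 ∘ u = F_map Hpi /\ u ∘ F_map He = e1.
Proof.
intros A1 A2 A3 A4 A5 A6 A7.
destruct (point_is_F A1) as [Y [zeta [v [[v' [L R]] [Ep Ee]]]]].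
(* The square makes [pi1] and [e1] morphisms of points, which lift to [p : Y -> X] and [s : X -> Y];
   faithfulness turns [pi1 e1 = 1] into [p s = 1]. *)
destruct (@F_map_full _ _ _ _ zeta xiX (pi1 ∘ v) c) as [p [Hp Epi1]].
{ now rewrite comp_assoc, A4, <- comp_assoc, Ep. }
{ now rewrite <- comp_assoc, Ee. }
destruct (@F_map_full _ _ _ _ xiX zeta (v' ∘ e1) (σι2 xiX)) as [s [Hs Ee1]].
{ now rewrite <- Ep, comp_assoc, <- (comp_assoc pi2), R, comp_id_r. }
{ now rewrite <- comp_assoc, A7, <- Ee, !comp_assoc, L, comp_id_l. }
assert (ps : p ∘ s = id X).
{ refine (F_map_faithful (H := is_act_hom_comp Hs Hp)
    (H' := is_act_hom_id xiX) _ A3).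
  rewrite (F_map_comp coeqs Hs Hp), F_map_id, Epi1, Ee1.
  now rewrite comp_assoc, <- (comp_assoc pi1), R, comp_id_r. }
destruct (point_is_F ps) as [Z [xiZ [w [[w' [Lw Rw]] [Epw Esw]]]]].
(* The action on [Y] is moved along [w'] to [F xiZ], with the acting object fixed. *)
destruct (action_transport zeta Lw Rw (comp_id_l (id (F xiX)))
  (comp_id_l (id (F xiX)))) as [xiF [H H']].
assert (Hpi : is_act_hom xiF xiX (bar01 xiZ) c).
{ rewrite <- Epw, <- (comp_id_r c). exact (is_act_hom_comp H' Hp). }
assert (He : is_act_hom xiX xiF (σι2 xiZ) (σι2 xiX)).
{ assert (E : σι2 xiZ = w' ∘ s) by now rewrite <- Esw, comp_assoc, Lw, comp_id_l.
  rewrite E, <- (comp_id_l (σι2 xiX)). exact (is_act_hom_comp Hs H). }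
exists Z, xiZ, xiF, Hpi, He, (v ∘ F_map H'). repeat split.
- exists (F_map H ∘ v'). split.
  + rewrite !comp_assoc, <- (comp_assoc _ v'), L.
    apply F_ext2; F_simpl; [|reflexivity].
    now rewrite <- comp_assoc, Lw, comp_id_r.
  + rewrite !comp_assoc, <- (comp_assoc v).
    replace (F_map H' ∘ F_map H) with (id (F zeta)); [now rewrite comp_id_r|].
    apply F_ext2; F_simpl; [|reflexivity].
    now rewrite <- comp_assoc, Rw, comp_id_r.
- rewrite comp_assoc, Ep. now F_simpl.
- now F_simpl.
- rewrite comp_assoc, <- Epi1. apply F_ext2; F_simpl; [|reflexivity].
  now rewrite <- comp_assoc, Epw.
- rewrite <- (comp_id_l e1), <- R, <- (comp_assoc v v'), <- Ee1, <- comp_assoc.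
  f_equal. apply F_ext2; F_simpl; [|reflexivity].
  now rewrite <- comp_assoc, Esw.
Qed.

Lemma TwoChainComp_to_PC_essentially_surjective :
  essentially_surjective TwoChainComp_to_PC.
Proof.
intros [C2 C1 C0 pi1 pi2 m e1 e2 d c e P1 P2 P3 P4 P5 P6 P7 P8 P9 P10 P11 P12].
destruct (point_is_F P3) as [X [xiX [u [[u' [Lu Ru]] [Ed Ee]]]]].
assert (Ec : (c ∘ u) ∘ σι2 xiX = id C0) by now rewrite <- comp_assoc, Ee.
assert (Eu' : u' ∘ e = σι2 xiX)
  by now rewrite <- Ee, comp_assoc, Lu, comp_id_l.
assert (Ed' : bar01 xiX ∘ u' = d)
  by now rewrite <- Ed, <- comp_assoc, Ru, comp_id_r.
assert (cancel : forall (W V : C) (a : hom C1 W) (b : hom V C1),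
  (a ∘ u) ∘ (u' ∘ b) = a ∘ b).
{ intros. now rewrite comp_assoc, <- (comp_assoc a), Ru, comp_id_r. }
(* The split square is conjugated by [u], so that [F xiX] takes the place of [C1]. *)
destruct (@split_square_is_F _ _ _ xiX (u' ∘ pi1) (u' ∘ pi2) (e1 ∘ u) (e2 ∘ u)
  (c ∘ u)) as [Z [xiZ [xiF [Hpi [He [v [[v' [Lv Rv]] [Q1 [Q2 [Q3 Q4]]]]]]]]]].
{ now rewrite comp_assoc, <- (comp_assoc u'), P1, comp_id_r. }
{ now rewrite comp_assoc, <- (comp_assoc u'), P2, comp_id_r. }
{ exact Ec. }
{ now rewrite comp_assoc, Ed', cancel. }
{ now rewrite comp_assoc, <- (comp_assoc u'), P6, !comp_assoc, Eu'. }
{ now rewrite comp_assoc, <- (comp_assoc u'), P7, !comp_assoc, Eu', <- Ed,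
    comp_assoc. }
{ now rewrite <- !comp_assoc, Ee. }
assert (Hh : [c ∘ u ∘ σι1 xiX, id C0] ∘ k = (c ∘ u ∘ σι1 xiX) ∘ xiX).
{ rewrite <- Ec. apply bar_restrict. }
assert (Eh : bar Hh = c ∘ u).
{ apply F_ext2; F_simpl; [reflexivity | now rewrite Ec]. }
(* The composition [m] is read between the reconstructed objects; the next four facts are its axioms
   in that form. *)
pose (n := u' ∘ m ∘ v).
assert (Nd : bar01 xiX ∘ n = bar01 xiX ∘ bar01 xiF).
{ unfold n. now rewrite !comp_assoc, Ed', P9, <- Ed', <- (comp_assoc _ u' pi2),
    <- comp_assoc, Q1. }
assert (Nc : c ∘ u ∘ n = c ∘ u ∘ F_map Hpi).
{ unfold n. now rewrite <- Q3, <- !(comp_assoc u'), !cancel, !comp_assoc, P10. }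
assert (Ne1 : n ∘ F_map He = id _).
{ unfold n. now rewrite <- comp_assoc, Q4, <- comp_assoc, (comp_assoc m), P11,
    comp_id_l. }
assert (Ne2 : n ∘ σι2 xiF = id _).
{ unfold n. now rewrite <- comp_assoc, Q2, <- comp_assoc, (comp_assoc m), P12,
    comp_id_l. }
destruct (@sigma_iota1_kernel _ _ _ xiX (n ∘ σι1 xiF)) as [w Ew].
{ rewrite comp_assoc, Nd. now F_simpl. }
assert (Ew2 : w ∘ σι2 xiZ = id X).
{ apply (sigma_iota1_mono (xi := xiX)).
  rewrite comp_assoc, Ew, <- comp_assoc, <- (F_map_iota1 He), comp_assoc, Ne1.
  now rewrite comp_id_l, comp_id_r. }
assert (Ht : [w ∘ σι1 xiZ, id X] ∘ k = (w ∘ σι1 xiZ) ∘ xiZ).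
{ rewrite <- Ew2. apply bar_restrict. }
assert (Et : bar Ht = w).
{ apply F_ext2; F_simpl; [reflexivity | now rewrite Ew2]. }
assert (Hht : (c ∘ u ∘ σι1 xiX) ∘ (w ∘ σι1 xiZ) = zero Z C0).
{ rewrite comp_assoc, <- (comp_assoc (c ∘ u)), Ew, comp_assoc, Nc.
  now F_simpl. }
(* As [bar Ht = w] and [σι1 w = n σι1], the two components are the restrictions of [n]. *)
assert (HF : [σι1 xiX ∘ bar Ht, id (F xiX)] ∘ k = (σι1 xiX ∘ bar Ht) ∘ xiF).
{ rewrite Et, Ew, <- Ne2. apply bar_restrict. }
assert (Em : bar HF = n).
{ apply F_ext2; F_simpl; [now rewrite <- Ew, Et | now rewrite Ne2]. }
assert (Hbar : bar01 xiZ ∘ xiF = xiX ∘ (bar Hh ♭m bar01 xiZ)).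
{ rewrite Eh. symmetry. exact Hpi. }
pose (P := {| tc_ht := Hht; tc_eq_F := HF; tc_eq_bar := Hbar;
              tc_eq_sigma := eq_sym He |}).
exists P.
(* The base components are [bar Hh] and [c ∘ u], which agree only through [Eh]. *)
assert (Epi : chain_pi1 P = F_map Hpi).
{ unfold chain_pi1. simpl. apply F_ext2; F_simpl; [reflexivity|].
  now rewrite Eh, !comp_assoc. }
assert (Ee1 : chain_e1 P = F_map He).
{ unfold chain_e1. simpl. now apply F_ext2; F_simpl. }
unshelve eexists.
{ refine (@Build_PrecategoryHom C (precategory_of_chain P)
    (Build_Precategory P1 P2 P3 P4 P5 P6 P7 P8 P9 P10 P11 P12)
    v u (id C0) _ _ _ _ _ _ _ _); simpl.
  - now rewrite Epi, <- Q3, !comp_assoc, Ru, comp_id_l.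
  - now rewrite <- Q1, !comp_assoc, Ru, comp_id_l.
  - rewrite Em. unfold n. now rewrite !comp_assoc, Ru, comp_id_l.
  - now rewrite Ee1, Q4.
  - now rewrite Q2.
  - now rewrite Ed, comp_id_l.
  - now rewrite Eh, comp_id_l.
  - now rewrite Ee, comp_id_r. }
apply PC_iso; [now exists v' | now exists u' |].
exists (id C0). split; apply comp_id_l.
Qed.

End Reconstruction.

End InternalActions.

Theorem theorem13 (B : PointedCategory)
    (prods : BinaryProducts B)
    (coprods : BinaryCoproducts B)
    (kers : SplitEpiKernels B)
    (coeqs : ReflexiveCoequalizers B) :
  is_equivalence (T coprods kers coeqs) ->
  equivalent_categories (RG B) (PreXMod coprods kers) /\
  equivalent_categories (PC B) (TwoChainComp coprods kers coeqs).
Proof.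
intros HT. split.
- exact (equivalent_from_functor (PreXMod_to_RG_full HT)
    (PreXMod_to_RG_faithful HT) (PreXMod_to_RG_essentially_surjective HT)).
- exact (equivalent_from_functor (TwoChainComp_to_PC_full HT)
    (TwoChainComp_to_PC_faithful HT)
    (TwoChainComp_to_PC_essentially_surjective HT)).
Qed.
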